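(* Let $N\ge 0$ be an integer and let $\mathcal{P}$ be a vertex-mapped pyramid with map $\boldsymbol{F}:\widehat{\mathcal{P}}\to\mathcal{P}$ and Jacobian determinant $J$. For $0\le k\le N$ let $a_0^k,\dots,a_k^k$ and $b_0^k,\dots,b_k^k$ denote the $(k+1)$-point Gauss-Legendre quadrature points on $[-1,1]$ (in the variables $a$ and $b$ respectively), with corresponding weights $w_0^k,\dots,w_k^k$. For $0\le k\le N$ and $0\le i,j\le k$ define on the bi-unit cube $$\phi_{ijk}(a,b,c)=\ell_i^k(a)\,\ell_j^k(b)\left(\frac{1-c}{2}\right)^k P_{N-k}^{2k+3,0}(c),$$ where $\ell_i^k$ is the Lagrange polynomial of degree $k$ that equals $1$ at the $i$th of the $k+1$ Gauss-Legendre points and $0$ at the others, and $P_{N-k}^{2k+3,0}$ is the Jacobi polynomial of degree $N-k$ with weights $(2k+3,0)$. Then the functions $\phi_{ijk}$ are orthogonal with respect to the $L^2$ inner product over $\mathcal{P}$, i.e. the mass matrix $$M_{ijk,i'j'k'}=\int_{\widehat{\mathcal{P}}}\phi_{ijk}\,\phi_{i'j'k'}\,J\,dr\,ds\,dt$$ is diagonal, and its diagonal entries are $$M_{ijk,ijk}=J_{ijk}\,w_i^k\,w_j^k\,C_{N-k}^N,\qquad C_{N-k}^N=\frac{N+2}{2^{2k+2}(2k+3)},$$ where $J_{ijk}$ is the value of $J$ at the quadrature point $(a,b)=(a_i^k,b_j^k)$.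
   Context: Reference pyramid: $\widehat{\mathcal{P}}$ is the bi-unit right pyramid of points $(r,s,t)$ with $t\in[-1,1]$ and $r,s\in[-1,-t]$. The bi-unit cube $[-1,1]^3$ with coordinates $(a,b,c)$ is mapped to $\widehat{\mathcal{P}}$ by the Duffy-type map $$r=(1+a)\frac{1-c}{2}-1,\quad s=(1+b)\frac{1-c}{2}-1,\quad t=c,$$ whose change of variables factor is $((1-c)/2)^2$; functions of $(a,b,c)$ are regarded as functions on $\widehat{\mathcal{P}}$ via the inverse map (defined away from $t=1$), and as functions on $\mathcal{P}$ by composing further with $\boldsymbol{F}^{-1}$. Thus $\int_{\widehat{\mathcal P}} g\,dr\,ds\,dt=\int_{[-1,1]^3} g\,((1-c)/2)^2\,da\,db\,dc$. Vertex functions: $$v_1=\frac{(r+t)(s+t)}{2(1-t)},\quad v_2=-\frac{(r+t)(s+1)}{2(1-t)},\quad v_3=-\frac{(r+1)(s+t)}{2(1-t)},\quad v_4=\frac{(r+1)(s+1)}{2(1-t)},\quad v_5=\frac{1+t}{2}.$$ A vertex-mapped pyramid $\mathcal{P}$ with vertices $\boldsymbol{V}_1,\dots,\boldsymbol{V}_5\in\mathbb{R}^3$ is the image of $\widehat{\mathcal{P}}$ under $\boldsymbol{F}(r,s,t)=\sum_{i=1}^5\boldsymbol{V}_i v_i(r,s,t)$. $J$ is the determinant of the Jacobian matrix of $\boldsymbol{F}$ with respect to $(r,s,t)$; the vertices are assumed to be such that the change of variables $\int_{\mathcal{P}}u\,dx\,dy\,dz=\int_{\widehat{\mathcal{P}}}u\,J\,dr\,ds\,dt$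 holds (e.g. $\boldsymbol F$ is injective and $J>0$ away from the apex). Expressed in $(a,b,c)$, $J$ is a polynomial of degree at most $1$ in each of $a$ and $b$ and is independent of $c$, so its value at $(a_i^k,b_j^k)$ is well defined. Jacobi polynomials are normalized to be orthonormal: $P_n^{\alpha,\beta}$ is the degree-$n$ polynomial with positive leading coefficient such that $\int_{-1}^1(1-c)^\alpha(1+c)^\beta P_n^{\alpha,\beta}P_m^{\alpha,\beta}\,dc=\delta_{nm}$. *)

(* Defs.v *)
From HB Require Import structures.
From mathcomp Require Import all_boot all_order all_algebra.
From mathcomp Require Import all_classical all_reals all_analysis.

Set Implicit Arguments.
Unset Strict Implicit.
Unset Printing Implicit Defensive.

Import Order.TTheory GRing.Theory Num.Theory.
Import numFieldNormedType.Exports.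

Local Open Scope classical_set_scope.
Local Open Scope ring_scope.

(* Points of R^3 are triples ((r, s), t), so that Lebesgue measure on R^3 is an
   iterated product measure. *)
Notation R3 R := (R * R * R)%type.

Definition leb1 (R : realType) := @lebesgue_measure R.

Definition leb3 (R : realType) := ((@leb1 R \x @leb1 R) \x @leb1 R)%E.

(* The library states [jacobian] for maps between spaces of row vectors. *)
Definition row_of_R3 (R : realType) (x : R3 R) : 'rV[R]_3 :=
  \row_(i < 3) [:: x.1.1; x.1.2; x.2]`_i.

Definition R3_of_row (R : realType) (v : 'rV[R]_3) : R3 R :=
  (v 0 (inord 0), v 0 (inord 1), v 0 (inord 2)).

Definition ref_pyramid (R : realType) : set (R3 R) :=
  [set x | [/\ -1 <= x.2 <= 1, -1 <= x.1.1 <= - x.2 & -1 <= x.1.2 <= - x.2]].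

Definition duffy (R : realType) (y : R3 R) : R3 R :=
  let: (a, b, c) := y in
  ((1 + a) * ((1 - c) / 2) - 1, (1 + b) * ((1 - c) / 2) - 1, c).

(* At t = 1, a null set, division by zero gives an irrelevant value. *)
Definition duffy_inv (R : realType) (x : R3 R) : R3 R :=
  let: (r, s, t) := x in
  (2 * (1 + r) / (1 - t) - 1, 2 * (1 + s) / (1 - t) - 1, t).

Lemma duffyK (R : realType) (y : R3 R) : y.2 != 1 -> duffy_inv (duffy y) = y.
Proof.
case: y => [[a b] c] /= c1; have h : 1 - c != 0 by rewrite subr_eq0 eq_sym.
have e z : 2 * (1 + ((1 + z) * ((1 - c) / 2) - 1)) / (1 - c) - 1 = z.
  rewrite [1 + (_ - 1)]addrC subrK [(1 + z) * _]mulrC !mulrA.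
  by rewrite [2 * _]mulrC mulfK ?pnatr_eq0// mulrAC mulfV// mul1r addrC addKr.
by rewrite !e.
Qed.

(* The vertex functions v_1, ..., v_5, indexed from 0. At the apex
   (-1, -1, 1) division by zero gives v_1 = ... = v_4 = 0 and v_5 = 1, which are
   the limits along the pyramid. *)
Definition vertex_fun (R : realType) (i : 'I_5) (x : R3 R) : R :=
  let: (r, s, t) := x in
  [:: (r + t) * (s + t) / (2 * (1 - t));
      - ((r + t) * (s + 1) / (2 * (1 - t)));
      - ((r + 1) * (s + t) / (2 * (1 - t)));
      (r + 1) * (s + 1) / (2 * (1 - t));
      (1 + t) / 2]`_i.

Definition vmap (R : realType) (V : 'I_5 -> R3 R) (x : R3 R) : R3 R :=
  \sum_(i < 5) vertex_fun i x *: V i.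

Definition pyramid (R : realType) (V : 'I_5 -> R3 R) : set (R3 R) :=
  vmap V @` @ref_pyramid R.

(* [jacobian] acts on row vectors on the right, hence is the transpose of the
   usual Jacobian matrix; the determinant is the same. *)
Definition jac (R : realType) (V : 'I_5 -> R3 R) (x : R3 R) : R :=
  \det (jacobian (@row_of_R3 R \o vmap V \o @R3_of_row R) (row_of_R3 x)).

(* Injectivity makes sense of functions on the pyramid given by composition
   with the inverse of [vmap V]. *)
Definition vertex_mapped (R : realType) (V : 'I_5 -> R3 R) : Prop :=
  {in @ref_pyramid R &, injective (vmap V)} /\
  forall u : R3 R -> R,
    (@leb3 R).-integrable (pyramid V) (EFin \o u) ->
    (\int[@leb3 R]_(y in pyramid V) (u y)%:E =
     \int[@leb3 R]_(x in @ref_pyramid R) (u (vmap V x) * jac V x)%:E)%E.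

Definition jacobi_orthonormal (R : realType) (alpha beta : nat)
    (p : nat -> {poly R}) : Prop :=
  (forall n, size (p n) = n.+1 /\ 0 < lead_coef (p n)) /\
  (forall n m,
    \int[@leb1 R]_(c in `[(-1 : R), 1])
      ((1 - c) ^+ alpha * (1 + c) ^+ beta * (p n).[c] * (p m).[c])
    = (n == m)%:R).

Definition lagrange_basis (R : realType) (k : nat) (x : 'I_k.+1 -> R)
    (i : 'I_k.+1) : {poly R} :=
  \prod_(j < k.+1 | j != i) ((x i - x j)^-1 *: ('X - (x j)%:P)).

(* The nodes are the k+1 roots, in some order, of a Legendre polynomial q of
   degree k+1, and the weights are those of the interpolatory quadrature. *)
Definition gauss_legendre (R : realType) (q : {poly R}) (k : nat)
    (x w : 'I_k.+1 -> R) : Prop :=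
  [/\ injective x, forall i, root q (x i) &
      forall i, w i = \int[@leb1 R]_(a in `[(-1 : R), 1])
                        (lagrange_basis x i).[a]].

(* phi_{ijk} on the cube; [p alpha beta n] stands for P_n^{alpha,beta}. *)
Definition phi_cube (R : realType) (p : nat -> nat -> nat -> {poly R})
    (N k : nat) (x : 'I_k.+1 -> R) (i j : 'I_k.+1) (y : R3 R) : R :=
  let: (a, b, c) := y in
  (lagrange_basis x i).[a] * (lagrange_basis x j).[b] *
  ((1 - c) / 2) ^+ k * (p (2 * k + 3)%N 0%N (N - k)%N).[c].

Definition phi_ref (R : realType) (p : nat -> nat -> nat -> {poly R})
    (N k : nat) (x : 'I_k.+1 -> R) (i j : 'I_k.+1) : R3 R -> R :=
  phi_cube p N x i j \o @duffy_inv R.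

Definition phi_phys (R : realType) (V : 'I_5 -> R3 R)
    (p : nat -> nat -> nat -> {poly R})
    (N k : nat) (x : 'I_k.+1 -> R) (i j : 'I_k.+1) : R3 R -> R :=
  phi_ref p N x i j \o pinv (@ref_pyramid R) (vmap V).

(* Both pairings are integrals in the extended reals: unlike a real-valued
   integral, such an integral has a finite value only if it converges. *)
Definition L2_inner (R : realType) (V : 'I_5 -> R3 R) (f g : R3 R -> R) :
    \bar R :=
  (\int[@leb3 R]_(y in pyramid V) (f y * g y)%:E)%E.

Definition mass (R : realType) (V : 'I_5 -> R3 R) (f g : R3 R -> R) :
    \bar R :=
  (\int[@leb3 R]_(x in @ref_pyramid R) (f x * g x * jac V x)%:E)%E.

Definition Cconst (R : realType) (N k : nat) : R :=
  (N + 2)%N%:R / (2 ^+ (2 * k + 2)%N * (2 * k + 3)%N%:R).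

(* Main.v *)
Require Import Defs.
From HB Require Import structures.
From mathcomp Require Import all_boot all_order all_algebra.
From mathcomp Require Import all_classical all_reals all_analysis.
From mathcomp Require Import measurable_realfun.
From mathcomp Require Import ring lra zify.

Set Implicit Arguments.
Unset Strict Implicit.
Unset Printing Implicit Defensive.

Import Order.TTheory GRing.Theory Num.Theory.
Import numFieldNormedType.Exports.

Local Open Scope classical_set_scope.
Local Open Scope ring_scope.

(** In the collapsed coordinates (a, b, c) the map F is V_5 + h (G - V_5) with
    h = (1 - c) / 2 and G bilinear in (a, b).  The determinant of its Jacobian
    with respect to (r, s, t) is therefore a polynomial in (a, b) of degree at
    most one in each variable, free of c ([jac_duffy], [jac_poly_bilinear]).
    All basis functions are products of a function of a, one of b and one of c,
    and the slice of the pyramid at height t is a square, so that Fubini's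
    theorem turns an entry of the mass matrix into a combination of four
    products of integrals over [-1, 1] ([integral_tensor_ref],
    [mass_tensor_ref]).  Three facts about polynomials finish the computation.

    - For k = k', the integrand l_i l_j a^m (m <= 1) has degree at most 2k + 1,
      so Gauss-Legendre quadrature integrates it exactly; at the nodes the
      Lagrange polynomials are 0 or 1 ([pint_lagrange_pair]).
    - For k < k', the vertical integral pairs the Jacobi polynomial of degree
      N - k, with its own weight (1 - c)^(2k+3), against a polynomial of degree
      N - k - 1, and vanishes ([pint_vertical_factor_neq]).
    - For k = k', the vertical weight is (1 - c)^(2k+2), one power short of the
      orthonormality weight.  Integrating the derivative of
      (1 - c)^(a+1) (1 + c) P_n^2, which vanishes at both ends, expresses this
      integral through orthonormality ([pint_jacobi_sub1]) and yields the
      constant C.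

    The statement over the physical pyramid reduces to the one over the
    reference pyramid by the change of variables, which applies to integrable
    functions.  A product of two basis functions is integrable because it is
    bounded and measurable: the pyramid is the image of the cube under the
    polynomial map F o duffy, so superlevel sets are countable unions of
    compact sets, up to the apex ([measurable_pyramid_fun]). *)

(** * Integrals of polynomials over [-1, 1] *)

Section PolynomialIntegral.
Context {R : realType}.
Implicit Types p q f g : {poly R}.

(** At index 0 the coefficient is divided by 0, hence is 0. *)
Definition antideriv p : {poly R} := \poly_(i < (size p).+1) (p`_i.-1 / i%:R).

Lemma deriv_antideriv p : deriv (antideriv p) = p.
Proof.
apply/polyP => i; rewrite coef_deriv coef_poly ltnS /= -[_ *+ i.+1]mulr_natr.
case: ltnP => hi; last by rewrite nth_default ?mul0r.
by rewrite mulfVK ?pnatr_eq0.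
Qed.

Lemma horner_deriv0 p (u v : R) : deriv p = 0 -> p.[u] = p.[v].
Proof.
move=> p0; suff -> : p = (p`_0)%:P by rewrite !hornerC.
apply/polyP => -[|i]; rewrite coefC //=.
have /eqP : (deriv p)`_i = 0 by rewrite p0 coef0.
by rewrite coef_deriv -mulr_natr mulf_eq0 pnatr_eq0 orbF => /eqP.
Qed.

(** Working with this algebraic value of the integral makes linearity and
    integration by parts identities between polynomials. *)
Definition pint p : R := (antideriv p).[1] - (antideriv p).[-1].

Lemma pint_deriv q : pint (deriv q) = q.[1] - q.[-1].
Proof.
rewrite /pint; set P := antideriv _.
have D0 : deriv (P - q) = 0 by rewrite derivB deriv_antideriv subrr.
have := horner_deriv0 1 (-1) D0; rewrite !hornerD !hornerN => h.
by apply/eqP; rewrite -subr_eq0; apply/eqP; move: h; lra.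
Qed.

Lemma pint_is_linear : linear pint.
Proof.
move=> c p q; have -> : c *: p + q = deriv (c *: antideriv p + antideriv q).
  by rewrite derivD derivZ !deriv_antideriv.
by rewrite pint_deriv !hornerD !hornerZ /pint /GRing.scale /=; ring.
Qed.

HB.instance Definition _ :=
  GRing.isLinear.Build R {poly R} R _ pint pint_is_linear.

Lemma pintD p q : pint (p + q) = pint p + pint q.
Proof. exact: raddfD. Qed.

Lemma pintZ c p : pint (c *: p) = c * pint p.
Proof. exact: linearZ. Qed.

Lemma integral_deriv_horner q (u v : R) : u <= v ->
  (\int[@leb1 R]_(z in `[u, v]) (deriv q).[z]%:E = (q.[v] - q.[u])%:E)%E.
Proof.
rewrite le_eqVlt => /predU1P[<-|uv].
  by rewrite set_itv1 integral_set1 ?subrr.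
rewrite (@continuous_FTC2 _ (horner (deriv q)) (horner q)) //.
- by apply: continuous_subspaceT; exact: continuous_horner.
- split.
  + by move=> z _; exact: derivable_horner.
  + by apply: cvg_at_right_filter; exact: continuous_horner.
  + by apply: cvg_at_left_filter; exact: continuous_horner.
- by move=> z _; rewrite derivE.
Qed.

Lemma integral_horner_ereal p :
  (\int[@leb1 R]_(z in `[(-1)%R, 1%R]) p.[z]%:E = (pint p)%:E)%E.
Proof.
have le11 : (-1 : R) <= 1 by lra.
by have := integral_deriv_horner (antideriv p) le11; rewrite deriv_antideriv.
Qed.

Lemma integral_horner p :
  \int[@leb1 R]_(z in `[(-1 : R), 1]) p.[z] = pint p.
Proof. by rewrite /Rintegral integral_horner_ereal. Qed.

(** * Jacobi polynomials *)

Section Jacobi.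
Variables (alpha beta : nat) (P : nat -> {poly R}).
Hypothesis P_orthonormal : jacobi_orthonormal alpha beta P.

Lemma size_jacobi n : size (P n) = n.+1.
Proof. by have [/(_ n)[]] := P_orthonormal. Qed.

Lemma pint_jacobi n m :
  pint ((1 - 'X) ^+ alpha * (1 + 'X) ^+ beta * P n * P m) = (n == m)%:R.
Proof.
have [_ <-] := P_orthonormal; rewrite -integral_horner.
by apply: eq_Rintegral => z _; rewrite !hornerE.
Qed.

(** Subtracting from [f] a multiple of the [m]-th Jacobi polynomial removes its
    coefficient of degree [m]; induction on the degree then only meets Jacobi
    polynomials of index different from [n]. *)
Lemma pint_jacobi_lower n f : (size f <= n)%N ->
  pint ((1 - 'X) ^+ alpha * (1 + 'X) ^+ beta * P n * f) = 0.
Proof.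
suff main m g : (size g <= m)%N -> (m <= n)%N ->
    pint ((1 - 'X) ^+ alpha * (1 + 'X) ^+ beta * P n * g) = 0.
  by move=> fn; apply: (main n).
elim: m g => [|m IH] g.
  by rewrite size_poly_leq0 => /eqP -> _; rewrite mulr0 raddf0.
move=> gm mn; set c := g`_m / (P m)`_m.
have Pm0 : (P m)`_m != 0.
  have [/(_ m)[sm]] := P_orthonormal; rewrite /lead_coef sm /= => h _.
  by rewrite gt_eqF.
have hg : (size (g - c *: P m)%R <= m)%N.
  apply/leq_sizeP => j; rewrite leq_eqVlt coefB coefZ => /predU1P[<-|mj].
    by rewrite /c mulfVK // subrr.
  rewrite !nth_default ?mulr0 ?subrr //; first by rewrite size_jacobi.
  exact: leq_trans gm mj.
rewrite -[g](subrK (c *: P m)) mulrDr -scalerAr pintD pintZ.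
rewrite IH ?(ltnW mn) // pint_jacobi.
by rewrite gtn_eqF //= mulr0n mulr0 addr0.
Qed.

End Jacobi.

(** The polynomial (1 - c)^(a+1) (1 + c) P_n^2 vanishes at both ends, so its
    derivative has integral 0.  Writing 1 + c = 2 - (1 - c) and
    (1 + c) P_n' = n P_n + g with g of degree less than n, that derivative is
    - 2 (a+1) (1 - c)^a P_n^2 + (2n + a + 2) (1 - c)^(a+1) P_n^2 plus a term
    orthogonal to P_n; orthonormality evaluates the middle term. *)
Lemma pint_jacobi_sub1 a (P : nat -> {poly R}) n :
  jacobi_orthonormal a.+1 0 P ->
  pint ((1 - 'X) ^+ a * P n * P n) =
  (2 * n + a.+1 + 1)%:R / (2 * a.+1)%:R.
Proof.
move=> hP; set p := P n; set g := (1 + 'X) * deriv p - n%:R *: p.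
have sp : size p = n.+1 by exact: size_jacobi hP n.
have sg : (size g <= n)%N.
  apply/leq_sizeP => j nj.
  rewrite /g mulrDl mul1r coefB coefD coefZ coefXM !coef_deriv.
  rewrite [p`_j.+1]nth_default ?sp ?ltnS // mul0rn add0r.
  case: j nj => [|j] nj; first by move: nj; rewrite leqn0 => /eqP ->; rewrite mul0r subr0.
  move: nj; rewrite leq_eqVlt => /predU1P[->|nj].
    by rewrite /= mulr_natl subrr.
  by rewrite nth_default ?sp // mul0rn mulr0 subrr.
have e : deriv ((1 - 'X) ^+ a.+1 * (1 + 'X) * p * p) =
    - (2 * a.+1)%:R *: ((1 - 'X) ^+ a * p * p)
    + (2 * n + a.+1 + 1)%:R *: ((1 - 'X) ^+ a.+1 * (1 + 'X) ^+ 0 * p * p)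
    + 2 *: ((1 - 'X) ^+ a.+1 * (1 + 'X) ^+ 0 * p * g).
  rewrite /g !derivM deriv_exp !poly.derivE /= expr0 -!mul_polyC.
  rewrite !natrD !natrM !rmorphN !rmorphD /= !rmorphM /= !rmorph_nat.
  by rewrite exprS -mulr_natr; ring.
have := pint_deriv ((1 - 'X) ^+ a.+1 * (1 + 'X) * p * p).
rewrite e !pintD !pintZ (pint_jacobi hP) (pint_jacobi_lower hP) // eqxx.
rewrite !hornerE !subrr expr0n /= !(mul0r, mulr0, addr0) subrr => h.
apply: (@mulfI _ (2 * a.+1)%:R); first by rewrite pnatr_eq0.
rewrite mulrC mulrAC [RHS]mulrC mulfVK ?pnatr_eq0 //.
by move: h; rewrite mulNr mulrC addrC => /subr0_eq.
Qed.

(** * Gauss-Legendre quadrature *)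

Section Gauss.
Variables (k : nat) (x : 'I_k.+1 -> R).
Hypothesis x_inj : injective x.

Lemma lagrange_basis_node i j : (lagrange_basis x i).[x j] = (i == j)%:R.
Proof.
rewrite /lagrange_basis horner_prod; case: eqVneq => [<-|ij].
  rewrite big1 // => l li; rewrite !hornerE mulVf // subr_eq0.
  by apply: contraNneq li => /x_inj ->.
by rewrite (bigD1 j) 1?eq_sym //= !hornerE subrr mulr0 mul0r.
Qed.

Lemma size_lagrange_basis i : (size (lagrange_basis x i) <= k.+1)%N.
Proof.
apply: leq_trans (size_poly_prod_leq _ _) _.
have card_neq : #|(fun j => j != i)| = k.
  by have := cardC1 i; rewrite card_ord.
rewrite leq_subLR card_neq addnS ltnS.
apply: leq_trans (_ : \sum_(j < k.+1 | j != i) 2 <= _)%N.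
  apply: leq_sum => j _; apply: leq_trans (size_scale_leq _ _) _.
  by rewrite size_XsubC.
by rewrite sum_nat_const card_neq muln2 addnn.
Qed.

Lemma lagrange_interpolation f : (size f <= k.+1)%N ->
  f = \sum_i f.[x i] *: lagrange_basis x i.
Proof.
move=> sf; apply/eqP; rewrite -subr_eq0; apply/eqP.
apply: (@roots_geq_poly_eq0 _ _ (codom x)).
- apply/allP => _ /codomP[j ->]; rewrite /root hornerD hornerN horner_sum.
  rewrite (bigD1 j) //= big1 => [|i ij]; rewrite hornerZ lagrange_basis_node.
    by rewrite eqxx mulr1 addr0 subrr.
  by rewrite (negbTE ij) mulr0.
- by rewrite /codom map_inj_uniq // enum_uniq.
- rewrite size_codom card_ord; apply: leq_trans (size_polyD _ _) _.
  rewrite geq_max sf size_polyN; apply: leq_trans (size_sum _ _ _) _.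
  apply/bigmax_leqP => i _; apply: leq_trans (size_scale_leq _ _) _.
  exact: size_lagrange_basis.
Qed.

End Gauss.

(** Dividing [f] by the Legendre polynomial leaves a remainder with the same
    values at the nodes, integrated exactly by the interpolatory rule, and a
    quotient of degree at most [k], to which the Legendre polynomial is
    orthogonal. *)
Lemma gauss_legendre_exact (P : nat -> {poly R}) k (x w : 'I_k.+1 -> R) f :
  jacobi_orthonormal 0 0 P -> gauss_legendre (P k.+1) x w ->
  (size f <= 2 * k.+1)%N -> pint f = \sum_i w i * f.[x i].
Proof.
move=> hP [x_inj xroot xw] sf; set q := P k.+1.
have sq : size q = k.+2 := size_jacobi hP k.+1.
have q0 : q != 0 by rewrite -size_poly_eq0 sq.
have sr : (size (f %% q)%R <= k.+1)%N by rewrite -ltnS -sq ltn_modp.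
have fx i : f.[x i] = (f %% q).[x i].
  by rewrite {1}(divp_eq f q) hornerD hornerM (rootP (xroot i)) mulr0 add0r.
rewrite {1}(divp_eq f q) pintD mulrC.
have := pint_jacobi_lower hP (n := k.+1) (f := f %/ q).
rewrite !expr0 !mul1r => -> ; last first.
  by rewrite size_divp // sq /= leq_subLR addnn -mul2n.
rewrite add0r {1}(lagrange_interpolation x_inj sr) raddf_sum.
by apply: eq_bigr => i _; rewrite [LHS]pintZ -integral_horner -xw fx mulrC.
Qed.

End PolynomialIntegral.

(** * The Jacobian of the vertex map *)

Section Jacobian.
Context {R : realType}.

Section IsDiff.
Variables (V W : normedModType R) (x : V).

Lemma is_diff_sum n (f df : 'I_n -> V -> W) :
  (forall i, is_diff x (f i) (df i)) ->
  is_diff x (\sum_(i < n) f i) (\sum_(i < n) df i).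
Proof.
move=> h; elim/big_ind2: _ => //; first exact: is_diff_cst.
by move=> ? ? ? ? ? ?; exact: is_diffD.
Qed.

Lemma is_diff_scale_cst (k dk : V -> R) (w : W) :
  is_diff x k dk -> is_diff x (fun z => k z *: w) (fun z => dk z *: w).
Proof.
move=> hk; apply: DiffDef; first exact: differentiableZl.
by rewrite diffZl // diff_val.
Qed.

Lemma is_diff_inv (f df : V -> R) : f x != 0 ->
  is_diff x f df -> is_diff x (fun z => (f z)^-1) (- (f x) ^- 2 *: df).
Proof.
move=> fx0 hf; apply: DiffDef; first exact: differentiableV.
by rewrite diffV // diff_val.
Qed.

End IsDiff.

Lemma is_diff_coord m n (M : 'M[R]_(m, n)) i j :
  is_diff M (fun N : 'M[R]_(m, n) => N i j : R) (fun N => N i j).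
Proof.
apply: DiffDef; first exact: differentiable_coord.
pose f (N : 'M[R]_(m, n)) : R := N i j.
have flin : linear f by move=> a u v; rewrite /f !mxE.
pose glM := GRing.isLinear.Build _ _ _ _ _ flin.
pose gL : {linear 'M[R]_(m, n) -> R} := HB.pack f glM.
have gc : continuous gL by exact: coord_continuous.
exact: (diff_lin M gc).
Qed.

(** The differential at [x], in the direction [u], of the [i]-th vertex
    function; [d] is the quotient rule for f g / (2 (1 - t)). *)
Definition dvertex_fun (i : 'I_5) (x u : R3 R) : R :=
  let: (r, s, t) := x in let: (dr, ds, dt) := u in
  let q := (2 * (1 - t))^-1 in
  let d f df g dg := (df * g + f * dg) * q + 2 * f * g * q ^+ 2 * dt in
  [:: d (r + t) (dr + dt) (s + t) (ds + dt);
      - d (r + t) (dr + dt) (s + 1) ds;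
      - d (r + 1) dr (s + t) (ds + dt);
      d (r + 1) dr (s + 1) ds;
      dt / 2]`_i.

Lemma is_diff_vertex_fun (i : 'I_5) (x : R3 R) : x.2 != 1 ->
  is_diff (row_of_R3 x) (@vertex_fun R i \o @R3_of_row R)
    (dvertex_fun i x \o @R3_of_row R).
Proof.
move=> t1; set p := row_of_R3 x.
have xE : x = R3_of_row p.
  by case: x @p t1 => -[r s] t p _; rewrite /R3_of_row /p /row_of_R3 !mxE !inordK.
pose cr (v : 'rV[R]_3) : R := v 0 (inord 0).
pose cs (v : 'rV[R]_3) : R := v 0 (inord 1).
pose ct (v : 'rV[R]_3) : R := v 0 (inord 2).
have hr : is_diff p cr cr := is_diff_coord _ _ _.
have hs : is_diff p cs cs := is_diff_coord _ _ _.
have ht : is_diff p ct ct := is_diff_coord _ _ _.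
have c1 : is_diff p (cst 1 : _ -> R) 0 := is_diff_cst _ _.
pose e (v : 'rV[R]_3) : R := 2 * (1 - ct v).
have he : is_diff p e (2 *: (0 - ct)).
  have -> : e = 2 *: (cst 1 - ct) by [].
  exact: is_diffZ.
have e0 : e p != 0.
  by move: t1; rewrite xE /e /ct /= mulf_eq0 pnatr_eq0 /= subr_eq0 eq_sym.
have hq := is_diff_inv e0 he.
(* The four base functions are, up to sign, f g / (2 (1 - t)) with f, g affine. *)
have H (f df g dg : 'rV[R]_3 -> R) : is_diff p f df -> is_diff p g dg ->
    is_diff p (fun v => f v * g v / (2 * (1 - ct v)))
     (fun u => (df u * g p + f p * dg u) * (e p)^-1 +
               2 * f p * g p * (e p)^-1 ^+ 2 * ct u).
  move=> hf hg; apply: is_diff_eq.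
  apply/funext => u.
  transitivity (f p * g p * (- (e p) ^- 2 * (2 * (0 - ct u)))
                + (e p)^-1 * (f p * dg u + g p * df u)); first by [].
  by rewrite -exprVn; ring.
rewrite {1}xE.
case: i => -[|[|[|[|[|//]]]]] hi.
- have -> : dvertex_fun (Ordinal hi) (R3_of_row p) \o @R3_of_row R =
    fun u => ((cr + ct) u * (cs + ct) p + (cr + ct) p * (cs + ct) u) * (e p)^-1 +
               2 * (cr + ct) p * (cs + ct) p * (e p)^-1 ^+ 2 * ct u by [].
  by apply: H; exact: is_diffD.
- have -> : dvertex_fun (Ordinal hi) (R3_of_row p) \o @R3_of_row R =
    - (fun u => ((cr + ct) u * (cs + cst 1) p + (cr + ct) p * (cs + 0) u) * (e p)^-1 +
               2 * (cr + ct) p * (cs + cst 1) p * (e p)^-1 ^+ 2 * ct u).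
    by apply/funext => u; rewrite /= !fctE addr0.
  by apply: is_diffN; apply: H; exact: is_diffD.
- have -> : dvertex_fun (Ordinal hi) (R3_of_row p) \o @R3_of_row R =
    - (fun u => ((cr + 0) u * (cs + ct) p + (cr + cst 1) p * (cs + ct) u) * (e p)^-1 +
               2 * (cr + cst 1) p * (cs + ct) p * (e p)^-1 ^+ 2 * ct u).
    by apply/funext => u; rewrite /= !fctE addr0.
  by apply: is_diffN; apply: H; exact: is_diffD.
- have -> : dvertex_fun (Ordinal hi) (R3_of_row p) \o @R3_of_row R =
    fun u => ((cr + 0) u * (cs + cst 1) p + (cr + cst 1) p * (cs + 0) u) * (e p)^-1 +
               2 * (cr + cst 1) p * (cs + cst 1) p * (e p)^-1 ^+ 2 * ct u.
    by apply/funext => u; rewrite /= !fctE !addr0.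
  by apply: H; exact: is_diffD.
- have -> : dvertex_fun (Ordinal hi) (R3_of_row p) \o @R3_of_row R =
    2^-1 *: (0 + ct).
    by apply/funext => u; rewrite /= !fctE add0r mulrC.
  have -> : @vertex_fun R (Ordinal hi) \o @R3_of_row R = 2^-1 *: (cst 1 + ct).
    by apply/funext => u; rewrite /= !fctE mulrC.
  by apply: is_diffZ; exact: is_diffD.
Qed.

Definition coord3 (y : R3 R) (j : nat) : R := [:: y.1.1; y.1.2; y.2]`_j.

Lemma coord3D (y z : R3 R) j : coord3 (y + z) j = coord3 y j + coord3 z j.
Proof. by rewrite /coord3; case: j => [|[|[|[|j]]]] //=; rewrite addr0. Qed.

Lemma coord3Z k (y : R3 R) j : coord3 (k *: y) j = k * coord3 y j.
Proof. by rewrite /coord3; case: j => [|[|[|[|j]]]] //=; rewrite mulr0. Qed.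

Lemma coord3N (y : R3 R) j : coord3 (- y) j = - coord3 y j.
Proof. by rewrite -scaleN1r coord3Z mulN1r. Qed.

Lemma row_of_vmap (V : 'I_5 -> R3 R) :
  @row_of_R3 R \o vmap V \o @R3_of_row R =
  \sum_(l < 5) fun v => (@vertex_fun R l \o @R3_of_row R) v *: row_of_R3 (V l).
Proof.
apply/funext => v; rewrite fct_sumE /vmap; apply/rowP => j.
rewrite summxE mxE.
have -> (y : R3 R) : [:: y.1.1; y.1.2; y.2]`_j = coord3 y j by [].
have coord3_sum (f : 'I_5 -> R3 R) : coord3 (\sum_l f l) j = \sum_l coord3 (f l) j.
  elim/big_ind2: _ => //; first by rewrite -[0](scale0r 0) coord3Z mul0r.
  by move=> y ? z ? <- <-; exact: coord3D.
rewrite /= coord3_sum; apply: eq_bigr => l _; rewrite !mxE.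
exact: coord3Z.
Qed.

Lemma jacE (V : 'I_5 -> R3 R) (x : R3 R) : x.2 != 1 ->
  jac V x = \det (\matrix_(i < 3, j < 3)
     \sum_(l < 5)
       dvertex_fun l x ((val i == 0%N)%:R, (val i == 1%N)%:R, (val i == 2%N)%:R)
       * coord3 (V l) j).
Proof.
move=> x1; congr (\det _); apply/matrixP => i j; rewrite !mxE row_of_vmap.
have h : is_diff (row_of_R3 x) _ _ := is_diff_sum (fun l =>
  is_diff_scale_cst (row_of_R3 (V l)) (is_diff_vertex_fun l x1)).
rewrite diff_val fct_sumE summxE; apply: eq_bigr => l _; rewrite !mxE /=.
congr (dvertex_fun _ _ _ * _); rewrite /R3_of_row !mxE !eqxx /=.
have E k : (k < 3)%N -> (inord k == i :> 'I_3) = (val i == k).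
  by move=> k3; rewrite -(inj_eq val_inj) /= inordK // eq_sym.
by rewrite !E.
Qed.

Lemma det_mx33 (m : nat -> nat -> R) :
  \det (\matrix_(i < 3, j < 3) m i j) =
    m 0%N 0%N * (m 1%N 1%N * m 2%N 2%N - m 1%N 2%N * m 2%N 1%N)
  - m 0%N 1%N * (m 1%N 0%N * m 2%N 2%N - m 1%N 2%N * m 2%N 0%N)
  + m 0%N 2%N * (m 1%N 0%N * m 2%N 1%N - m 1%N 1%N * m 2%N 0%N).
Proof.
rewrite (expand_det_row _ ord0) !big_ord_recl big_ord0 /cofactor.
rewrite !(expand_det_row _ ord0) !big_ord_recl !big_ord0 /cofactor !det_mx11.
rewrite !mxE /= /bump /= !addn0 !expr0 !expr1 ?add0n expr2 ?exprS ?expr0.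
ring.
Qed.

(** Away from the apex, with w = (r + 1) (s + 1) / (2 (1 - t)), the map F equals
    w D + (r + 1) / 2 E1 + (s + 1) / 2 E2 + (1 + t) / 2 E3 up to a constant.
    The coefficients of D below are the partial derivatives of w, rewritten in
    (a, b); they do not involve c. *)
Definition jac_entry (V : 'I_5 -> R3 R) (a b : R) (i j : nat) : R :=
  let D := V 0 - V 1 - V (inord 2) + V (inord 3) in
  let E1 := V (inord 2) - V 0 in
  let E2 := V 1 - V 0 in
  let E3 := V (inord 4) - V 0 in
  [:: (1 + b) / 4 * coord3 D j + coord3 E1 j / 2;
      (1 + a) / 4 * coord3 D j + coord3 E2 j / 2;
      (1 + a) * (1 + b) / 8 * coord3 D j + coord3 E3 j / 2]`_i.

Definition jac_poly (V : 'I_5 -> R3 R) (a b : R) : R :=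
  \det (\matrix_(i < 3, j < 3) jac_entry V a b i j).

Lemma jac_duffy (V : 'I_5 -> R3 R) (a b c : R) : c != 1 ->
  jac V (duffy (a, b, c)) = jac_poly V a b.
Proof.
move=> c1; rewrite jacE //; congr (\det _); apply/matrixP => i j; rewrite !mxE.
have h0 : 1 - c != 0 by rewrite subr_eq0 eq_sym.
rewrite !big_ord_recl big_ord0 /jac_entry.
rewrite !coord3D !coord3N.
have -> : inord 2 = lift ord0 (lift ord0 ord0) :> 'I_5 by apply/val_inj; rewrite /= inordK.
have -> : inord 3 = lift ord0 (lift ord0 (lift ord0 ord0)) :> 'I_5 by apply/val_inj; rewrite /= inordK.
have -> : inord 4 = lift ord0 (lift ord0 (lift ord0 (lift ord0 ord0))) :> 'I_5 by apply/val_inj; rewrite /= inordK.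
have -> : 1 = lift ord0 ord0 :> 'I_5 by apply/val_inj.
have -> : 0 = ord0 :> 'I_5 by [].
case: i => -[|[|[|//]]] hi; rewrite /= /bump /=; field; exact: h0.
Qed.

(** The only nonconstant parts of the three rows are multiples of the same
    vector D, so the determinant is affine in those three coefficients, which
    are 1 + b, 1 + a and (1 + a) (1 + b) up to constants. *)
Lemma jac_poly_bilinear (V : 'I_5 -> R3 R) : exists e00 e10 e01 e11 : R,
  forall a b, jac_poly V a b = e00 + e10 * a + e01 * b + e11 * (a * b).
Proof.
pose F := jac_poly V.
exists (F 0 0), (F 1 0 - F 0 0), (F 0 1 - F 0 0), (F 1 1 - F 1 0 - F 0 1 + F 0 0).
by move=> a b; rewrite /F /jac_poly !(det_mx33 (jac_entry _ _ _)) /jac_entry /=; field.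
Qed.

End Jacobian.

(** * The reference pyramid *)

Section PyramidIntegral.
Context {R : realType}.
Notation mu := (@leb1 R).

Lemma measurable_inv : measurable_fun [set: R] (@GRing.inv R).
Proof.
rewrite -(setvU [set (0 : R)]); apply/measurable_funU.
- exact: measurableC.
- exact: measurable_set1.
- split; last exact: measurable_fun_set1.
  apply: open_continuous_measurable_fun.
    by rewrite openC; exact: closed_eq.
  by move=> z; rewrite inE /= => /eqP z0; exact: inv_continuous.
Qed.

Lemma measurable_coord (D : set (R3 R)) :
  [/\ measurable_fun D (fun x : R3 R => x.1.1),
      measurable_fun D (fun x : R3 R => x.1.2) &
      measurable_fun D (fun x : R3 R => x.2)].
Proof.
split; apply: measurable_funTS.
- by apply: (measurableT_comp measurable_fst); exact: measurable_fst.
- by apply: (measurableT_comp measurable_snd); exact: measurable_fst.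
- exact: measurable_snd.
Qed.

Lemma measurable_ref_pyramid : measurable (@ref_pyramid R).
Proof.
have [m1 m2 m3] := measurable_coord setT.
pose b (x : R3 R) := [&& -1 <= x.2, x.2 <= 1, -1 <= x.1.1, x.1.1 <= - x.2,
   -1 <= x.1.2 & x.1.2 <= - x.2].
have mb : measurable_fun setT b.
  do 5?[apply: measurable_and]; apply: measurable_fun_ler => //;
    by [exact: measurable_cst|apply: measurableT_comp].
have -> : @ref_pyramid R = setT `&` b @^-1` [set true].
  rewrite setTI; apply/seteqP; split=> x; rewrite /ref_pyramid /b /=.
    by move=> [/andP[-> ->] /andP[-> ->] /andP[-> ->]].
  by move=> /and5P[-> -> -> -> /andP[-> ->]].
exact: mb.
Qed.

Lemma horner_bounded (A : {poly R}) :
  exists M : R, forall a, -1 <= a <= 1 -> `|A.[a]| <= M.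
Proof.
exists (\sum_(i < size A) `|A`_i|) => a a1; rewrite horner_coef.
apply: le_trans (ler_norm_sum _ _ _) _; apply: ler_sum => i _.
by rewrite normrM ler_piMr // normrX exprn_ile1 // ler_norml.
Qed.

Lemma duffy_invK (x : R3 R) : x.2 != 1 -> duffy (duffy_inv x) = x.
Proof.
case: x => -[r s] t /= t1; have t0 : 1 - t != 0 by rewrite subr_eq0 eq_sym.
by congr (_, _, _); field.
Qed.

(** At t = 1 division by zero gives a = b = -1, still in the cube. *)
Lemma duffy_inv_cube (x : R3 R) : @ref_pyramid R x ->
  let y := duffy_inv x in
  [/\ -1 <= y.1.1 <= 1, -1 <= y.1.2 <= 1 & -1 <= y.2 <= 1].
Proof.
case: x => -[r s] t [] /= /andP[t1 t2] /andP[r1 r2] /andP[s1 s2].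
have H z : -1 <= z -> z <= - t -> -1 <= 2 * (1 + z) / (1 - t) - 1 <= 1.
  move=> z1 z2; have [t1'|t1'] := eqVneq t 1.
    by rewrite t1' subrr invr0 mulr0; apply/andP; split; lra.
  have t0 : 0 < 1 - t by rewrite subr_gt0 lt_neqAle t1' t2.
  apply/andP; split.
    by rewrite -lerBlDr opprK addNr divr_ge0 //; lra.
  by rewrite lerBlDr ler_pdivrMr //; lra.
by split; [exact: H|exact: H|rewrite t1 t2].
Qed.

Lemma leb3_bounded (A : set (R3 R)) (m : R) : measurable A ->
  (forall x, A x ->
    [/\ - m <= x.1.1 <= m, - m <= x.1.2 <= m & - m <= x.2 <= m]) ->
  (@leb3 R A < +oo)%E.
Proof.
move=> mA Am.
pose I : set (measurableTypeR R) := `[- m, m]%classic.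
have mI : measurable I by exact: measurable_itv.
apply: (@le_lt_trans _ _ (@leb3 R ((I `*` I) `*` I))).
  apply: le_measure; rewrite ?inE.
  - exact: mA.
  - by apply: measurableX => //; exact: measurableX.
  - by move=> x /Am[x1 x2 x3]; split; [split|]; rewrite /I /= in_itv.
have -> : @leb3 R ((I `*` I) `*` I) = (mu I * mu I * mu I)%E.
  rewrite /leb3 product_measure1E //; last exact: measurableX.
  by congr (_ * _)%E; exact: product_measure1E.
have [l ->] : exists l : R, mu I = l%:E.
  rewrite /I /leb1 lebesgue_measure_itv /=.
  by case: ifP => _; rewrite -?EFinB; eexists.
by rewrite -!EFinM ltry.
Qed.

Lemma leb3_ref_pyramid : (@leb3 R (@ref_pyramid R) < +oo)%E.
Proof.
apply: (leb3_bounded (m := 1)); first exact: measurable_ref_pyramid.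
case=> -[r s] t [] /= /andP[t1 t2] /andP[r1 r2] /andP[s1 s2].
by split; apply/andP; split; lra.
Qed.

Definition tensor_ref (A B C : {poly R}) (x : R3 R) : R :=
  let y := duffy_inv x in A.[y.1.1] * B.[y.1.2] * C.[y.2].

Lemma measurable_tensor_ref A B C D : measurable_fun D (tensor_ref A B C).
Proof.
have [m1 m2 m3] := measurable_coord D.
have mq : measurable_fun D (fun x : R3 R => (1 - x.2)^-1).
  apply: (measurableT_comp measurable_inv); apply: measurable_funB.
    exact: measurable_cst.
  exact: m3.
have ma (f : R3 R -> R) : measurable_fun D f ->
    measurable_fun D (fun x => 2 * (1 + f x) / (1 - x.2) - 1).
  move=> mf; apply: measurable_funB; last exact: measurable_cst.
  apply: measurable_funM => //; apply: measurable_funM; first exact: measurable_cst.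
  by apply: measurable_funD => //; exact: measurable_cst.
have mh (A' : {poly R}) (f : R3 R -> R) : measurable_fun D f ->
    measurable_fun D (fun x => A'.[f x]).
  move=> mf; apply: measurableT_comp mf; apply: continuous_measurable_fun.
  exact: continuous_horner.
rewrite (_ : tensor_ref A B C = fun x : R3 R =>
  A.[2 * (1 + x.1.1) / (1 - x.2) - 1] * B.[2 * (1 + x.1.2) / (1 - x.2) - 1] *
  C.[x.2]); last by apply/funext => -[[]].
by apply: measurable_funM; [apply: measurable_funM|]; apply: mh => //; exact: ma.
Qed.

Lemma tensor_ref_bounded A B C :
  exists M : R, forall x, @ref_pyramid R x -> `|tensor_ref A B C x| <= M.
Proof.
have [MA hA] := horner_bounded A; have [MB hB] := horner_bounded B.
have [MC hC] := horner_bounded C; exists (MA * MB * MC) => x /duffy_inv_cube[a b c].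
rewrite /tensor_ref !normrM; apply: ler_pM => //.
- by apply: ler_pM => //; [exact: hA|exact: hB].
- exact: hC.
Qed.

Lemma bounded_integrable_ref (f : R3 R -> R) (M : R) :
  measurable_fun (@ref_pyramid R) f ->
  (forall x, @ref_pyramid R x -> `|f x| <= M) ->
  (@leb3 R).-integrable (@ref_pyramid R) (EFin \o f).
Proof.
move=> mf fM; apply: measurable_bounded_integrable => //.
- exact: measurable_ref_pyramid.
- exact: leb3_ref_pyramid.
- exists M; split; first exact: num_real.
  by move=> z Mz x Dx; apply: le_trans (fM x Dx) (ltW Mz).
Qed.

(** The affine substitution r -> a maps the slice [-1, -t] onto [-1, 1] and
    contributes the factor (1 - t) / 2. *)
Lemma integral_slice (A : {poly R}) (t : R) : -1 <= t <= 1 ->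
  (\int[mu]_(r in `[(-1)%R, (- t)%R]) A.[2 * (1 + r) / (1 - t) - 1]%:E
   = ((1 - t) / 2 * pint A)%:E)%E.
Proof.
move=> /andP[t1 t2]; have [->|t1'] := eqVneq t 1.
  by rewrite set_itv1 integral_set1 subrr !mul0r.
have t0 : 1 - t != 0 by rewrite subr_eq0 eq_sym.
pose L : {poly R} := (2 / (1 - t)) *: 'X + (2 / (1 - t) - 1)%:P.
pose q := ((1 - t) / 2) *: (antideriv A \Po L).
have qE : deriv q = A \Po L.
  rewrite /q derivZ deriv_comp deriv_antideriv /L derivD derivZ derivX derivC.
  rewrite addr0 alg_polyC [_ * _%:P]mulrC mul_polyC scalerA -[RHS]scale1r; congr (_ *: _).
  by field.
transitivity (\int[mu]_(r in `[(-1)%R, (- t)%R]) (deriv q).[r]%:E)%E.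
  apply: eq_integral => r _; rewrite qE horner_comp; congr (_.[_]%:E).
  by rewrite /L !hornerE /=; ring.
rewrite integral_deriv_horner; last by lra.
rewrite /q !hornerZ !horner_comp /L !hornerE /= /pint -mulrBr; congr (_ * (_.[_] - _.[_]))%:E; by field.
Qed.

End PyramidIntegral.

(** * Fubini on the reference pyramid *)

Section ProductIntegral.
Context d1 d2 (T1 : measurableType d1) (T2 : measurableType d2) (R : realType).
Variables (m1 : {sigma_finite_measure set T1 -> \bar R})
  (m2 : {sigma_finite_measure set T2 -> \bar R}).

Lemma integral_prod_mul (f : T1 -> R) (g : T2 -> R) :
  m1.-integrable setT (EFin \o f) -> m2.-integrable setT (EFin \o g) ->
  (\int[(m1 \x m2)]_z (f z.1 * g z.2)%:E =
   \int[m1]_x (f x)%:E * \int[m2]_y (g y)%:E)%E.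
Proof.
move=> intf intg.
have mf : measurable_fun setT f by apply/measurable_EFinP; exact: measurable_int intf.
have mg : measurable_fun setT g by apply/measurable_EFinP; exact: measurable_int intg.
have gE : (\int[m2]_y (g y)%:E)%E = (fine (\int[m2]_y (g y)%:E))%:E.
  by rewrite fineK //; exact: integrable_fin_num intg.
have inth : (m1 \x m2)%E.-integrable setT (fun z => (f z.1 * g z.2)%:E).
  have mh : measurable_fun setT (fun z : T1 * T2 => (f z.1 * g z.2)%:E).
    apply/measurable_EFinP; apply: measurable_funM.
      by apply: measurableT_comp mf _; exact: measurable_fst.
    by apply: measurableT_comp mg _; exact: measurable_snd.
  apply/(integrable12ltyP _ _ mh).
  have absg : (\int[m2]_y `|(g y)%:E|)%E = (fine (\int[m2]_y `|(g y)%:E|))%:E.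
    by rewrite fineK //; exact: integrable_fin_num (integrable_abse intg).
  under eq_integral => x _.
    have -> : (\int[m2]_y `|(f (x, y).1 * g (x, y).2)%:E|
               = `|(f x)%:E| * (fine (\int[m2]_y `|(g y)%:E|))%:E)%E.
      rewrite -absg -(@integralZl _ _ _ m2 setT measurableT _ (integrable_abse intg)).
      by apply: eq_integral => y _; rewrite EFinM abseM.
    over.
  rewrite (@integralZr _ _ _ m1 setT measurableT _ (integrable_abse intf)).
  have absf := integrable_fin_num measurableT (integrable_abse intf).
  by rewrite -(fineK absf) -EFinM ltry.
rewrite -(integral12_prod_meas1 inth) /fubini_F /=.
under eq_integral => x _.
  have -> : (\int[m2]_y (f x * g y)%:E = (f x)%:E * (fine (\int[m2]_y (g y)%:E))%:E)%E.
    rewrite -gE -(@integralZl _ _ _ m2 setT measurableT _ intg).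
    by apply: eq_integral => y _; rewrite EFinM.
  over.
by rewrite (@integralZr _ _ _ m1 setT measurableT _ intf) -gE.
Qed.

End ProductIntegral.

Section TripleProductIntegral.
Context d1 d2 d3 (T1 : measurableType d1) (T2 : measurableType d2)
  (T3 : measurableType d3) (R : realType).
Variables (m1 : {sigma_finite_measure set T1 -> \bar R})
  (m2 : {sigma_finite_measure set T2 -> \bar R})
  (m3 : {sigma_finite_measure set T3 -> \bar R}).

Lemma sigma_finite_product : sigma_finite setT (m1 \x m2)%E.
Proof.
have [F F_cover F_fin] := sigma_finiteT m1.
have [G G_cover G_fin] := sigma_finiteT m2.
pose H n := match unpickle n with
  | Some ij => F ij.1 `*` G ij.2 | None => set0 end.
exists H => [|n].
  apply/seteqP; split=> // -[x y] _.
  have [i _ Fx] : (\bigcup_i F i) x by rewrite -F_cover.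
  have [j _ Gy] : (\bigcup_j G j) y by rewrite -G_cover.
  have [n nij] : exists n, unpickle n = Some (i, j).
    by exists (pickle (i, j)); exact: pickleK.
  by exists n => //; rewrite /H nij.
rewrite /H; case: unpickle => [[i j]|]; last by rewrite measure0.
have [mF Fi] := F_fin i; have [mG Gj] := G_fin j.
split; first exact: measurableX.
by rewrite product_measure1E // lte_mul_pinfty // ge0_fin_numE.
Qed.

Lemma integral_prod3 (f : T1 * T2 * T3 -> \bar R) :
  ((m1 \x m2) \x m3)%E.-integrable setT f ->
  (\int[(m1 \x m2) \x m3]_x f x = \int[m3]_t \int[m1 \x m2]_z f (z, t))%E.
Proof.
move=> intf.
(* Fubini's theorem takes the inner product as a sigma-finite measure. *)
pose m12 : {sigma_finite_measure set (T1 * T2)%type -> \bar R} :=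
  HB.pack (m1 \x m2)%E (Measure_isSigmaFinite.Build _ _ _ (m1 \x m2)%E sigma_finite_product).
symmetry; exact: (@integral21_prod_meas1 _ _ _ _ R m12 m3 f intf).
Qed.

End TripleProductIntegral.

Section TensorIntegral.
Context {R : realType}.
Notation mu := (@leb1 R).
Implicit Types A B C : {poly R}.

Definition shrink : {poly R} := 2^-1 *: (1 - 'X).

Definition slice_fun A (t : R) : R -> R :=
  (fun r => A.[2 * (1 + r) / (1 - t) - 1]) \_ `[-1, - t].

Lemma integrable_horner A (u v : R) :
  mu.-integrable (`[u, v] : set (measurableTypeR R)) (fun r => A.[r]%:E).
Proof.
apply: continuous_compact_integrable; first exact: segment_compact.
by apply: continuous_subspaceT; exact: continuous_horner.
Qed.

Lemma integrable_slice_fun A t : mu.-integrable setT (EFin \o slice_fun A t).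
Proof.
pose L : {poly R} := (2 / (1 - t)) *: 'X + (2 / (1 - t) - 1)%:P.
have mI : measurable (`[-1, - t]%classic : set (measurableTypeR R)).
  exact: measurable_itv.
rewrite /slice_fun -restrict_EFin; apply/(integrable_mkcond _ mI).
refine (eq_integrable _ _ _ _ (integrable_horner (A \Po L) (-1) (- t))) => //.
move=> r _.
by rewrite /L horner_comp !hornerE /=; congr (_.[_]%:E); ring.
Qed.

Lemma integral_slice_fun A t : -1 <= t <= 1 ->
  (\int[mu]_r (slice_fun A t r)%:E = ((1 - t) / 2 * pint A)%:E)%E.
Proof.
move=> t1; rewrite -(integral_slice _ t1) [RHS]integral_mkcond.
by apply: eq_integral => r _; rewrite /slice_fun !patchE; case: ifP.
Qed.

(** Each of the two horizontal integrals over a slice contributes a factor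
    (1 - t) / 2, which accounts for the square of [shrink]. *)
Lemma integral_tensor_ref A B C :
  (\int[@leb3 R]_(x in @ref_pyramid R) (tensor_ref A B C x)%:E
   = (pint A * pint B * pint (shrink ^+ 2 * C))%:E)%E.
Proof.
have mD : measurable (@ref_pyramid R : set (measurableTypeR R * measurableTypeR R * measurableTypeR R)) := measurable_ref_pyramid.
have [M hM] := tensor_ref_bounded A B C.
have intD := @bounded_integrable_ref R (tensor_ref A B C) M (@measurable_tensor_ref R A B C _) hM.
have intf : ((mu \x mu) \x mu)%E.-integrable setT ((EFin \o tensor_ref A B C) \_ (@ref_pyramid R)).
  exact: (iffLR (@integrable_mkcond _ _ R ((mu \x mu) \x mu)%E (@ref_pyramid R) (EFin \o tensor_ref A B C) mD) intD).
transitivity (\int[(mu \x mu) \x mu]_x ((EFin \o tensor_ref A B C) \_ (@ref_pyramid R)) x)%E.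
  exact: integral_mkcond.
etransitivity.
  exact: (@integral_prod3 _ _ _ _ _ _ R (@lebesgue_measure R)
    (@lebesgue_measure R) (@lebesgue_measure R) _ intf).
transitivity (\int[mu]_(t in `[(-1)%R, 1%R])
   (pint A * pint B * (shrink ^+ 2 * C).[t])%:E)%E.
  rewrite [RHS]integral_mkcond; apply: eq_integral => t _.
  rewrite patchE; case: ifPn => [|tI].
    rewrite inE /= in_itv /= => t1.
    transitivity (\int[mu \x mu]_z (slice_fun A t z.1 * (C.[t] * slice_fun B t z.2))%:E)%E.
      apply: eq_integral => -[r s] _; rewrite /slice_fun !patchE /tensor_ref /=.
      (* The slice of the pyramid at height t is a square. *)
      have -> : ((r, s, t) \in @ref_pyramid R) =
        (r \in `[(-1 : R), - t]%classic) && (s \in `[(-1 : R), - t]%classic).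
        apply/idP/idP => [/set_mem[/= _ r1 s1]|/andP[/set_mem /= + /set_mem /=]].
          by apply/andP; split; apply/mem_set; rewrite /= in_itv.
        by rewrite !in_itv /= => r1 s1; apply/mem_set; split.
      case: (r \in _) => /=; last by rewrite mul0r.
      case: (s \in _) => /=; last by rewrite !mulr0.
      by congr (_%:E); ring.
    have intB := integrableZl measurableT C.[t] (integrable_slice_fun B t).
    etransitivity.
      exact: (@integral_prod_mul _ _ _ _ R (@lebesgue_measure R)
        (@lebesgue_measure R) (slice_fun A t) (fun s => C.[t] * slice_fun B t s)
        (integrable_slice_fun A t) intB).
    rewrite integral_slice_fun //.
    under eq_integral => s _ do rewrite EFinM.
    rewrite (@integralZl _ _ _ mu setT measurableT _ (integrable_slice_fun B t)).
    rewrite integral_slice_fun // -!EFinM /shrink !hornerE /=; congr (_%:E).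
    by field.
  rewrite (_ : (fun x => _) = cst 0%E) ?integral0 //.
  apply/funext => -[r s]; rewrite patchE ifF //; apply: contraNF tI.
  by rewrite !inE /= in_itv /= => -[].
rewrite -(pintZ (pint A * pint B)) -integral_horner_ereal.
by apply: eq_integral => t _; rewrite hornerZ.
Qed.

End TensorIntegral.

(** * The physical pyramid *)

Section PhysicalPyramid.
Context {R : realType}.

(** The measurable sets here are those of the product sigma-algebra; an open
    set belongs to it as the countable union of the balls with rational center
    and radius that it contains. *)
Lemma open_measurable_R3 (U : set (R3 R)) : open U -> measurable U.
Proof.
move=> oU.
pose ctr (q : rat * rat * rat * rat) : R3 R :=
  (ratr q.1.1.1, ratr q.1.1.2, ratr q.1.2).
pose bq q : set (R3 R) := ball (ctr q) (ratr q.2).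
have mbq q : measurable (bq q).
  have -> : bq q = ball (ratr q.1.1.1 : R) (ratr q.2) `*` ball (ratr q.1.1.2 : R) (ratr q.2)
     `*` ball (ratr q.1.2 : R) (ratr q.2) by [].
  by apply: measurableX; [apply: measurableX|]; exact: measurable_ball.
pose F n : set (R3 R) := match unpickle n with
  | Some q => if `[< bq q `<=` U >] then bq q else set0 | None => set0 end.
rewrite (_ : U = \bigcup_n F n).
  apply: bigcupT_measurable => n; rewrite /F.
  by case: unpickle => // q; case: ifP.
apply/seteqP; split=> [x Ux|x [n _]]; last first.
  by rewrite /F; case: unpickle => // q; case: ifPn => // /asboolP; exact.
have /nbhs_ballP[e /= e0 xeU] := open_nbhs_nbhs (conj oU Ux).
have [r /[!in_itv]/= /andP[r0 re]] := rat_in_itvoo (divr_gt0 e0 (ltr0Sn R 1)).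
have near_rat z : exists q : rat, ball (ratr q : R) (ratr r) z.
  have [q /[!in_itv]/= /andP[q1 q2]] : exists q : rat, ratr q \in `]z - ratr r, z + ratr r[.
    by apply: rat_in_itvoo; lra.
  by exists q; rewrite /ball /= ltr_distlC; apply/andP; split; lra.
have [q1 h1] := near_rat x.1.1; have [q2 h2] := near_rat x.1.2.
have [q3 h3] := near_rat x.2.
pose q := (q1, q2, q3, r).
have qx : bq q x by [].
have [n nq] : exists n, unpickle n = Some q by exists (pickle q); exact: pickleK.
exists n; first by [].
rewrite /F nq ifT //; apply/asboolP => y qy.
apply: xeU; rewrite [e]splitr; apply: (ball_triangle (y := ctr q)).
  by apply: ball_sym; apply: le_ball qx; exact: ltW.
by apply: le_ball qy; exact: ltW.
Qed.

Lemma compact_measurable_R3 (K : set (R3 R)) : compact K -> measurable K.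
Proof.
move=> cK; rewrite -(setCK K); apply: measurableC; apply: open_measurable_R3.
by rewrite openC; apply: compact_closed cK; exact: norm_hausdorff.
Qed.

Definition cube : set (R3 R) :=
  (`[(-1 : R), 1] `*` `[(-1 : R), 1]) `*` `[(-1 : R), 1].

Lemma compact_cube : compact cube.
Proof. by do 2?apply: compact_setX; exact: segment_compact. Qed.

(** The vertex functions in the collapsed coordinates: the denominator 1 - t
    cancels.  At c = 1 they take the values given to the vertex functions at the
    apex, so the vertex map is continuous on the whole cube. *)
Definition collapsed_vertex_fun (i : 'I_5) (y : R3 R) : R :=
  [:: (1 - y.1.1) * (1 - y.1.2) * (1 - y.2) / 8;
      (1 - y.1.1) * (1 + y.1.2) * (1 - y.2) / 8;
      (1 + y.1.1) * (1 - y.1.2) * (1 - y.2) / 8;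
      (1 + y.1.1) * (1 + y.1.2) * (1 - y.2) / 8;
      (1 + y.2) / 2]`_i.

Lemma vertex_fun_duffy i y :
  vertex_fun i (duffy y) = collapsed_vertex_fun i y.
Proof.
case: y => -[a b] c; rewrite /collapsed_vertex_fun /=.
have [->|c1] := eqVneq c 1.
  by case: i => -[|[|[|[|[|//]]]]] hi /=; rewrite ?subrr ?(mul0r, mulr0, invr0, oppr0).
have c0 : 1 - c != 0 by rewrite subr_eq0 eq_sym.
by case: i => -[|[|[|[|[|//]]]]] hi /=; field.
Qed.

Lemma continuous_coord3 :
  [/\ continuous (fun y : R3 R => y.1.1), continuous (fun y : R3 R => y.1.2) &
      continuous (fun y : R3 R => y.2)].
Proof.
split=> y.
- apply: (@continuous_comp _ _ _ fst fst y); exact: cvg_fst.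
- apply: (@continuous_comp _ _ _ fst snd y); [exact: cvg_fst|exact: cvg_snd].
- exact: cvg_snd.
Qed.

Lemma continuous_collapsed_vertex_fun i : continuous (collapsed_vertex_fun i).
Proof.
move=> y; have [ca cb cc] := continuous_coord3.
have cD (f : R3 R -> R) : continuous f -> {for y, continuous (fun z : R3 R => 1 + f z : R)}.
  by move=> cf; apply: continuousD; [exact: cst_continuous|exact: cf].
have cB (f : R3 R -> R) : continuous f -> {for y, continuous (fun z : R3 R => 1 - f z : R)}.
  by move=> cf; apply: continuousB; [exact: cst_continuous|exact: cf].
have cM (f g : R3 R -> R) : {for y, continuous f} -> {for y, continuous g} ->
    {for y, continuous (fun z => f z * g z)}.
  exact: continuousM.
have cC (k : R) : {for y, continuous (fun _ : R3 R => k)}.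
  exact: cst_continuous.
case: i => -[|[|[|[|[|//]]]]] hi.
- exact: (cM _ _ (cM _ _ (cM _ _ (cB _ ca) (cB _ cb)) (cB _ cc)) (cC 8^-1)).
- exact: (cM _ _ (cM _ _ (cM _ _ (cB _ ca) (cD _ cb)) (cB _ cc)) (cC 8^-1)).
- exact: (cM _ _ (cM _ _ (cM _ _ (cD _ ca) (cB _ cb)) (cB _ cc)) (cC 8^-1)).
- exact: (cM _ _ (cM _ _ (cM _ _ (cD _ ca) (cD _ cb)) (cB _ cc)) (cC 8^-1)).
- exact: (cM _ _ (cD _ cc) (cC 2^-1)).
Qed.

Lemma continuous_vmap_duffy V : continuous (vmap V \o @duffy R).
Proof.
have -> : vmap V \o @duffy R = \sum_(i < 5) fun y => collapsed_vertex_fun i y *: V i.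
  apply/funext => z; rewrite fct_sumE; apply: eq_bigr => i _.
  by rewrite vertex_fun_duffy.
move=> y; elim/big_ind: _ => [|f g cf cg|i _].
- exact: cst_continuous.
- exact: continuousD.
- by apply: continuousZr_tmp; exact: continuous_collapsed_vertex_fun.
Qed.

Lemma ref_pyramid_duffy : @ref_pyramid R = @duffy R @` cube.
Proof.
apply/seteqP; split=> [x Dx|_ [[[a b] c] [[/= + +] +] <-]]; last first.
  rewrite /= !in_itv /= => /andP[a1 a2] /andP[b1 b2] /andP[c1 c2].
  by split; apply/andP; split => //=; nra.
have [t1|t1] := eqVneq x.2 1.
  exists (-1, -1, 1); first by split; [split|]; rewrite /= in_itv /= ?lexx ?lerN10 //; apply/andP; split; lra.
  case: x Dx t1 => -[r s] t /= [/= _ /andP[r1 r2] /andP[s1 s2]] t1.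
  by rewrite t1 !subrr !mul0r !add0r; congr (_, _, _); lra.
exists (duffy_inv x); last exact: duffy_invK.
by have [] := duffy_inv_cube Dx; rewrite /cube /= !in_itv.
Qed.

End PhysicalPyramid.

Section PhysicalPyramidIntegrable.
Context {R : realType}.
Variables (V : 'I_5 -> R3 R) (u Phi : R3 R -> R).
(* [u] is continuous in the collapsed coordinates, its value at the apex being
   arbitrary. *)
Hypothesis Phi_continuous : continuous Phi.
Hypothesis u_duffy :
  forall y, cube y -> y.2 != 1 -> u (vmap V (duffy y)) = Phi y.

Let G := vmap V \o @duffy R.

Lemma pyramidE : pyramid V = G @` cube.
Proof. by rewrite /pyramid ref_pyramid_duffy image_comp. Qed.

Lemma compact_pyramid : compact (pyramid V).
Proof.
rewrite pyramidE; apply: continuous_compact; last exact: compact_cube.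
apply: continuous_subspaceT; exact: continuous_vmap_duffy.
Qed.

Lemma vmap_duffy_top y : y.2 = 1 -> G y = V (inord 4).
Proof.
move=> y1; rewrite /G /= /vmap.
under eq_bigr => i _ do rewrite vertex_fun_duffy.
rewrite !big_ord_recl big_ord0 /collapsed_vertex_fun /= y1 subrr !mulr0 !mul0r.
rewrite !scale0r !add0r addr0 divff ?pnatr_eq0 // scale1r; congr V.
by apply/val_inj; rewrite /= inordK.
Qed.

(** A superlevel set of [u] is the union, over n, of the images of the compact
    sets of points of the cube with c <= 1 - 1/(n+1) where [Phi] is large,
    together with the apex if it qualifies. *)
Lemma measurable_pyramid_fun : measurable_fun (pyramid V) u.
Proof.
move=> mP; apply: (measurability _ (RGenCInfty.measurableE R)) => //.
move=> _ [_ [r ->] <-].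
pose K n : set (R3 R) :=
  cube `&` [set y | y.2 <= 1 - n.+1%:R^-1] `&` [set y | r <= Phi y].
have cK n : compact (G @` K n).
  apply: continuous_compact.
    by apply: continuous_subspaceT; exact: continuous_vmap_duffy.
  apply: compact_closedI; first (apply: compact_closedI; first exact: compact_cube).
    have [_ _ cc] := @continuous_coord3 R.
    exact: (preimage_closed (fun y _ => cc y) (@closed_le R (1 - n.+1%:R^-1))).
  exact: (preimage_closed (fun y _ => Phi_continuous (x := y)) (@closed_ge R r)).
have KG n y : K n y -> y.2 != 1.
  move=> [[_ /= yn] _]; apply: contraTneq yn => ->.
  by rewrite -ltNge ltrBlDr ltrDl invr_gt0 ltr0n.
pose top : set (R3 R) := [set z | [/\ pyramid V z, z = V (inord 4) & r <= u z]].
rewrite (_ : _ `&` _ = (\bigcup_n (G @` K n)) `|` top).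
  apply: measurableU.
    by apply: bigcupT_measurable => n; exact: compact_measurable_R3.
  have [h|h] := pselect (pyramid V (V (inord 4)) /\ r <= u (V (inord 4))).
    rewrite (_ : top = [set V (inord 4)]).
      apply: compact_measurable_R3; exact: compact_set1.
    by apply/seteqP; split=> [z []//|z ->]; case: h.
  rewrite (_ : top = set0) //.
  by apply/seteqP; split=> [z [Pz zE rz]|//]; apply: h; rewrite -zE.
apply/seteqP; split=> [z [Pz /=]|z].
  rewrite in_itv /= andbT => rz.
  move: (Pz); rewrite pyramidE => -[y Cy yz].
  have [y1|y1] := eqVneq y.2 1.
    by right; split => //; rewrite -yz vmap_duffy_top.
  left; have y1' : y.2 < 1.
    by move: Cy => [_ /=]; rewrite in_itv /= => /andP[_]; rewrite le_eqVlt (negbTE y1).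
  have [n hn] : exists n, y.2 <= 1 - n.+1%:R^-1.
    have := ltr_add_invr y1'; case=> n hn; exists n; rewrite lerBrDr; exact: ltW.
  exists n => //; exists y => //; split; first by split.
  by rewrite /= -u_duffy // -[vmap _ _]/(G y) yz.
case=> [[n _ [y Ky <-]]|[Pz _ rz]].
  have y1 := KG n y Ky; move: Ky => [[Cy _] /= ry].
  split; first by rewrite pyramidE; exists y.
  by rewrite /= in_itv /= andbT /G /= u_duffy.
by split; rewrite //= in_itv /= andbT.
Qed.

Lemma pyramid_fun_bounded : exists M : R, forall z, pyramid V z -> `|u z| <= M.
Proof.
have : compact (Phi @` cube).
  apply: continuous_compact (@compact_cube R).
  exact: continuous_subspaceT.
move=> /compact_bounded[M [_ hM]].
exists (Num.max (M + 1) `|u (V (inord 4))|) => z; rewrite pyramidE => -[y Cy <-].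
rewrite le_max; have [y1|y1] := eqVneq y.2 1.
  by rewrite vmap_duffy_top // lexx orbT.
by rewrite /G /= u_duffy // hM ?ltrDl //.
Qed.

Lemma leb3_pyramid : (@leb3 R (pyramid V) < +oo)%E.
Proof.
have [M [_ hM]] := compact_bounded compact_pyramid.
have Mm : M < M + 1 by rewrite ltrDl.
apply: (leb3_bounded (m := M + 1)).
  exact: compact_measurable_R3 compact_pyramid.
move=> [[a b] c] /(hM _ Mm) /=; rewrite prod_normE /= prod_normE /= !ge_max.
by rewrite !ler_norml => /andP[/andP[a1 b1] c1].
Qed.

Lemma integrable_pyramid_fun :
  (@leb3 R).-integrable (pyramid V) (EFin \o u).
Proof.
have [M hM] := pyramid_fun_bounded.
apply: measurable_bounded_integrable.
- exact: compact_measurable_R3 compact_pyramid.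
- exact: leb3_pyramid.
- exact: measurable_pyramid_fun.
- exists M; split; first exact: num_real.
  by move=> z Mz x Dx; apply: le_trans (hM x Dx) (ltW Mz).
Qed.

End PhysicalPyramidIntegrable.

(** * The mass matrix *)

Section Mass.
Context {R : realType}.
Notation mu := (@leb1 R).
Notation mu3 := ((mu \x mu) \x mu)%E.
Notation D := (@ref_pyramid R : set (measurableTypeR R * measurableTypeR R * measurableTypeR R)).
Implicit Types A B C : {poly R}.

Lemma integral_add_tensor_ref (f : R3 R -> R) (c e : R) A B C :
  mu3.-integrable D (EFin \o f) -> (\int[mu3]_(x in D) (f x)%:E = c%:E)%E ->
  mu3.-integrable D (EFin \o (fun x => f x + e * tensor_ref A B C x)) /\
  (\int[mu3]_(x in D) (f x + e * tensor_ref A B C x)%:E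
   = (c + e * (pint A * pint B * pint (shrink ^+ 2 * C)))%:E)%E.
Proof.
move=> intf fc; have mD : measurable D := measurable_ref_pyramid.
have [M hM] := tensor_ref_bounded A B C.
have intT : mu3.-integrable D (EFin \o tensor_ref A B C).
  exact: (@bounded_integrable_ref R (tensor_ref A B C) M (@measurable_tensor_ref R A B C _) hM).
have inteT := integrableZl mD e intT.
have E : EFin \o (fun x => f x + e * tensor_ref A B C x) =
    (EFin \o f) \+ (fun x => e%:E * (EFin \o tensor_ref A B C) x)%E.
  by apply/funext => x.
split; first by rewrite E; exact: integrableD.
transitivity (\int[mu3]_(x in D) ((EFin \o f) x + e%:E * (EFin \o tensor_ref A B C) x))%E.
  by apply: eq_integral.
rewrite (integralD mD intf inteT) fc (integralZl mD intT).
rewrite (_ : (\int[mu3]_(x in D) _)%E = (pint A * pint B * pint (shrink ^+ 2 * C))%:E) //.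
exact: integral_tensor_ref.
Qed.

Lemma tensor_refM A B C A' B' C' (x : R3 R) :
  tensor_ref A B C x * tensor_ref A' B' C' x = tensor_ref (A * A') (B * B') (C * C') x.
Proof. by rewrite /tensor_ref !hornerM; ring. Qed.

Definition apex : R3 R := (-1, -1, 1).

Lemma ref_pyramid_top x : @ref_pyramid R x -> x.2 = 1 -> x = apex.
Proof.
case: x => -[r s] t [/= _ /andP[r1 r2] /andP[s1 s2]] t1.
by move: r2 s2; rewrite t1 => r2 s2; congr (_, _, _); lra.
Qed.

Lemma measurable_apex : measurable ([set apex] : set (measurableTypeR R * measurableTypeR R * measurableTypeR R)).
Proof. by apply: compact_measurable_R3; exact: compact_set1. Qed.

Lemma leb3_apex : (mu3 [set apex] = 0)%E.
Proof.
have -> : [set apex] = ([set (-1 : R)] `*` [set (-1 : R)]) `*` [set (1 : R)].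
  apply/seteqP; split=> [_ ->//|[[a b] c] [[/= -> ->] ->]] //.
rewrite product_measure1E.
- by rewrite [X in (_ * X)%E]lebesgue_measure_set1 mule0.
- by apply: measurableX; exact: measurable_set1.
- exact: measurable_set1.
Qed.

(** The pyramid meets the plane t = 1 in the apex alone, a null set, so the
    values given there by division by zero do not affect integrals. *)
Lemma integral_ref_apex (f g : R3 R -> R) :
  measurable_fun D g ->
  (forall x, @ref_pyramid R x -> x.2 != 1 -> f x = g x) ->
  (\int[mu3]_(x in D) (f x)%:E = \int[mu3]_(x in D) (g x)%:E)%E.
Proof.
move=> mg fg; have mD : measurable D := measurable_ref_pyramid.
have fgD x : D x -> x <> apex -> f x = g x.
  move=> Dx xa; apply: fg => //; apply/eqP => x1; apply: xa.
  exact: ref_pyramid_top.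
have Dapex : D = (D `\ apex) `|` [set apex].
  rewrite setUC setD1K // /ref_pyramid /=.
  by split; apply/andP; split; lra.
have mD' : measurable (D `\ apex) by apply: measurableD => //; exact: measurable_apex.
have mf : measurable_fun D f.
  rewrite Dapex; apply/measurable_funU => //; first exact: measurable_apex.
  split; last exact: measurable_fun_set1.
  apply: (eq_measurable_fun g).
    by move=> x /set_mem [Dx xa]; rewrite fgD.
  by apply: measurable_funS mg => // x [].
apply: ae_eq_integral => //; [exact/measurable_EFinP|exact/measurable_EFinP|].
exists [set apex]; split; [exact: measurable_apex|exact: leb3_apex|].
move=> x /= h; apply: contrapT => xa; apply: h => Dx.
by rewrite fgD.
Qed.

(** Away from the apex the integrand is a combination of four functions that
    split in (a, b, c), one for each monomial 1, a, b, a b of the Jacobian. *)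
Lemma mass_tensor_ref V (e00 e10 e01 e11 : R) A B C A' B' C' :
  (forall a b, jac_poly V a b = e00 + e10 * a + e01 * b + e11 * (a * b)) ->
  mass V (tensor_ref A B C) (tensor_ref A' B' C') =
  ((e00 * (pint (A * A') * pint (B * B'))
    + e10 * (pint (A * A' * 'X) * pint (B * B'))
    + e01 * (pint (A * A') * pint (B * B' * 'X))
    + e11 * (pint (A * A' * 'X) * pint (B * B' * 'X)))
   * pint (shrink ^+ 2 * (C * C')))%:E.
Proof.
move=> jE; set A2 := A * A'; set B2 := B * B'; set C2 := C * C'.
have int0 : mu3.-integrable D (EFin \o (fun _ : R3 R => 0)) by exact: integrable0.
have h0 : (\int[mu3]_(x in D) ((fun _ => 0) x)%:E = 0%:E)%E by exact: integral0.
have [int1 h1] := integral_add_tensor_ref e00 A2 B2 C2 int0 h0.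
have [int2 h2] := integral_add_tensor_ref e10 (A2 * 'X) B2 C2 int1 h1.
have [int3 h3] := integral_add_tensor_ref e01 A2 (B2 * 'X) C2 int2 h2.
have [int4 h4] := integral_add_tensor_ref e11 (A2 * 'X) (B2 * 'X) C2 int3 h3.
have m4 := iffLR (measurable_EFinP _ _) (measurable_int _ int4).
rewrite /mass; etransitivity.
  apply: (integral_ref_apex m4) => x Dx x1.
  rewrite tensor_refM -[in jac V x](duffy_invK x1).
  have -> : duffy_inv x = (((duffy_inv x).1.1, (duffy_inv x).1.2), (duffy_inv x).2).
    by case: (duffy_inv x) => -[].
  rewrite jac_duffy; last by case: x x1 {Dx} => -[].
  by rewrite jE /tensor_ref /A2 /B2 /C2 !hornerM !hornerX; ring.
by rewrite h4; congr (_%:E); ring.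
Qed.

Section GaussJacobi.
Variables (p : nat -> nat -> nat -> {poly R}).
Hypothesis hp : forall alpha beta : nat, jacobi_orthonormal alpha beta (p alpha beta).

Definition vertical_factor (N k : nat) : {poly R} :=
  shrink ^+ k * p (2 * k + 3)%N 0%N (N - k)%N.

Lemma phi_cubeE N k (x : 'I_k.+1 -> R) i j (y : R3 R) :
  phi_cube p N x i j y =
  (lagrange_basis x i).[y.1.1] * (lagrange_basis x j).[y.1.2]
  * (vertical_factor N k).[y.2].
Proof.
case: y => -[a b] c; rewrite /phi_cube /vertical_factor /shrink /= hornerM.
rewrite horner_exp hornerZ hornerD hornerN hornerC hornerX.
by rewrite mulrA [2^-1 * _]mulrC.
Qed.

Lemma phi_refE N k (x : 'I_k.+1 -> R) i j :
  phi_ref p N x i j =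
  tensor_ref (lagrange_basis x i) (lagrange_basis x j) (vertical_factor N k).
Proof. by apply/funext => y; rewrite /phi_ref /= phi_cubeE. Qed.

(** The integrands have degree at most 2k + 1, within the exactness of the
    quadrature with k + 1 nodes. *)
Lemma pint_lagrange_pair k (x w : 'I_k.+1 -> R) i i' :
  gauss_legendre (p 0%N 0%N k.+1) x w ->
  pint (lagrange_basis x i * lagrange_basis x i') = (i == i')%:R * w i /\
  pint (lagrange_basis x i * lagrange_basis x i' * 'X) = (i == i')%:R * w i * x i.
Proof.
move=> gl; have [x_inj _ _] := gl.
have sl := size_lagrange_basis x.
have node (f : {poly R}) : (size (lagrange_basis x i * lagrange_basis x i' * f)%R <= 2 * k.+1)%N ->
    pint (lagrange_basis x i * lagrange_basis x i' * f) = (i == i')%:R * w i * f.[x i].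
  move=> sf; rewrite (gauss_legendre_exact (hp 0 0) gl sf) (bigD1 i) //= big1 => [|m mi].
    rewrite !hornerM !lagrange_basis_node // eqxx [i' == i]eq_sym.
    by rewrite addr0 mul1r mulrCA mulrA.
  by rewrite !hornerM lagrange_basis_node // eq_sym (negbTE mi) !mul0r mulr0.
have s2 : (size (lagrange_basis x i * lagrange_basis x i')%R <= (2 * k.+1).-1)%N.
  apply: leq_trans (size_polyMleq _ _) _.
  by move: (sl i) (sl i'); lia.
split.
  have := node 1; rewrite mulr1 hornerC mulr1; apply.
  exact: leq_trans s2 (leq_pred _).
have := node 'X; rewrite hornerX; apply.
apply: leq_trans (size_polyMleq _ _) _; rewrite size_polyX.
by move: s2; lia.
Qed.

(** Of the powers of 1 - c, 2k + 3 form the weight of the first Jacobi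
    polynomial and k' - k - 1 go to the second one, whose degree becomes
    N - k - 1 < N - k. *)
Lemma pint_vertical_factor_neq N k k' : (k < k')%N -> (k' <= N)%N ->
  pint (shrink ^+ 2 * (vertical_factor N k * vertical_factor N k')) = 0.
Proof.
move=> kk' k'N.
rewrite (_ : _ * _ = (2^-1 ^+ (2 + k + k')) *:
   ((1 - 'X) ^+ (2 * k + 3) * (1 + 'X) ^+ 0 * p (2 * k + 3)%N 0%N (N - k)%N
     * ((1 - 'X) ^+ (k' - k).-1 * p (2 * k' + 3)%N 0%N (N - k')%N))).
  rewrite pintZ (pint_jacobi_lower (hp _ _)) ?mulr0 //.
  apply: leq_trans (size_polyMleq _ _) _.
  rewrite (size_jacobi (hp _ _)) addnS /=.
  have sX n : (size ((1 - 'X : {poly R}) ^+ n)%R <= n.+1)%N.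
    apply: leq_trans (size_poly_exp_leq _ _) _.
    rewrite -opprB size_polyN size_XsubC /=; by rewrite mul1n.
  apply: leq_trans (leq_add (sX _) (leqnn _)) _.
  by lia.
rewrite /vertical_factor /shrink !exprZn -!scalerAl -!scalerAr !scalerA.
have E : (1 - 'X : {poly R}) ^+ (2 * k + 3) * (1 - 'X) ^+ (k' - k).-1 =
    (1 - 'X) ^+ 2 * (1 - 'X) ^+ k * (1 - 'X) ^+ k'.
  by rewrite -!exprD; congr (_ ^+ _); lia.
rewrite -!exprD addnA; congr (_ *: _).
by rewrite expr0 mulr1 [RHS]mulrACA E; ring.
Qed.

Lemma pint_vertical_factor N k : (k <= N)%N ->
  pint (shrink ^+ 2 * (vertical_factor N k * vertical_factor N k)) = Cconst R N k.
Proof.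
move=> kN; set P := p (2 * k + 3)%N 0%N (N - k)%N.
have -> : shrink ^+ 2 * (vertical_factor N k * vertical_factor N k) =
   (2^-1 ^+ (2 * k + 2)) *: ((1 - 'X) ^+ (2 * k + 2) * P * P).
  have E : (1 - 'X : {poly R}) ^+ (2 * k + 2) =
      (1 - 'X) ^+ 2 * (1 - 'X) ^+ k * (1 - 'X) ^+ k.
    by rewrite -!exprD; congr (_ ^+ _); lia.
  rewrite /vertical_factor -/P /shrink !exprZn -!scalerAl -!scalerAr !scalerA -!exprD.
  rewrite (_ : (2 + (k + k) = 2 * k + 2)%N); last by lia.
  by congr (_ *: _); rewrite E; ring.
have hP : jacobi_orthonormal (2 * k + 2).+1 0 (p (2 * k + 3)%N 0%N).
  by rewrite -addnS.
rewrite pintZ (pint_jacobi_sub1 _ hP) /Cconst -addnS exprVn.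
have -> : (2 * (N - k) + (2 * k + 3) + 1)%N = (2 * (N + 2))%N by lia.
rewrite !natrM; field.
by rewrite expf_neq0 ?pnatr_eq0 // andbT -natrM -natrD pnatr_eq0 addnS.
Qed.

Section Orthogonality.
Variables (N : nat) (V : 'I_5 -> R3 R) (x w : forall k : nat, 'I_k.+1 -> R).
Arguments x : clear implicits.
Arguments w : clear implicits.
Hypothesis hx : forall k : nat, (k <= N)%N ->
  gauss_legendre (p 0%N 0%N k.+1) (x k) (w k).

Lemma mass_phi_same k (i j i' j' : 'I_k.+1) : (k <= N)%N ->
  mass V (phi_ref p N (x k) i j) (phi_ref p N (x k) i' j') =
  ((i == i')%:R * (j == j')%:R *
   (jac_poly V (x k i) (x k j) * w k i * w k j * Cconst R N k))%:E.
Proof.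
move=> kN; have [e00 [e10 [e01 [e11 jE]]]] := jac_poly_bilinear V.
rewrite !phi_refE (mass_tensor_ref _ _ _ _ _ _ jE) pint_vertical_factor // jE.
have [-> ->] := pint_lagrange_pair i i' (hx kN).
have [-> ->] := pint_lagrange_pair j j' (hx kN).
by congr (_%:E); ring.
Qed.

Lemma mass_phi_neq k k' (i j : 'I_k.+1) (i' j' : 'I_k'.+1) :
  (k <= N)%N -> (k' <= N)%N -> k != k' ->
  mass V (phi_ref p N (x k) i j) (phi_ref p N (x k') i' j') = 0%E.
Proof.
move=> kN k'N kk'; have [e00 [e10 [e01 [e11 jE]]]] := jac_poly_bilinear V.
rewrite !phi_refE (mass_tensor_ref _ _ _ _ _ _ jE).
suff -> : pint (shrink ^+ 2 * (vertical_factor N k * vertical_factor N k')) = 0.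
  by rewrite mulr0.
case: (ltngtP k k') kk' => // [lt_kk'|lt_k'k] _; first exact: pint_vertical_factor_neq.
by rewrite [vertical_factor N k * _]mulrC; exact: pint_vertical_factor_neq.
Qed.

Lemma mass_phi_orthogonal k k' (i j : 'I_k.+1) (i' j' : 'I_k'.+1) :
  (k <= N)%N -> (k' <= N)%N ->
  (nat_of_ord i, nat_of_ord j, k) <> (nat_of_ord i', nat_of_ord j', k') ->
  mass V (phi_ref p N (x k) i j) (phi_ref p N (x k') i' j') = 0%E.
Proof.
move=> kN k'N; have [kk'|kk' _] := eqVneq k k'; last exact: mass_phi_neq.
move: i' j'; rewrite -kk' => i' j' ij; rewrite mass_phi_same //.
case: (eqVneq i i') ij => [<-|_ _]; last by rewrite !mul0r.
by case: (eqVneq j j') => [<- //|_ _]; rewrite mulr0 mul0r.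
Qed.

Lemma continuous_phi_cube k (i j : 'I_k.+1) :
  continuous (phi_cube p N (x k) i j).
Proof.
move=> y; have [ca cb cc] := @continuous_coord3 R.
have ch (A : {poly R}) (f : R3 R -> R) : continuous f ->
    {for y, continuous (fun z => A.[f z])}.
  by move=> cf; apply: continuous_comp; [exact: cf|exact: continuous_horner].
rewrite (funext (phi_cubeE N (x k) i j)).
exact: (continuousM (continuousM (ch _ _ ca) (ch _ _ cb)) (ch _ _ cc)).
Qed.

Lemma phi_phys_vmap k (i j : 'I_k.+1) z : vertex_mapped V ->
  @ref_pyramid R z -> phi_phys V p N (x k) i j (vmap V z) = phi_ref p N (x k) i j z.
Proof. by move=> [V_inj _] Dz; rewrite /phi_phys /= pinvKV // inE. Qed.

(** The change of variables turns one integral into the other; it is granted for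
    integrable functions, hence the appeal to [integrable_pyramid_fun]. *)
Lemma L2_inner_mass k k' (i j : 'I_k.+1) (i' j' : 'I_k'.+1) : vertex_mapped V ->
  L2_inner V (phi_phys V p N (x k) i j) (phi_phys V p N (x k') i' j') =
  mass V (phi_ref p N (x k) i j) (phi_ref p N (x k') i' j').
Proof.
move=> hV; have [_ changeV] := hV.
pose u y := phi_phys V p N (x k) i j y * phi_phys V p N (x k') i' j' y.
pose Phi y := phi_cube p N (x k) i j y * phi_cube p N (x k') i' j' y.
have uV z : @ref_pyramid R z -> u (vmap V z) =
    phi_ref p N (x k) i j z * phi_ref p N (x k') i' j' z.
  by move=> Dz; rewrite /u !phi_phys_vmap.
have Phi_cont : continuous Phi.
  by move=> y; apply: continuousM; exact: continuous_phi_cube.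
have u_duffy y : cube y -> y.2 != 1 -> u (vmap V (duffy y)) = Phi y.
  move=> Cy y1; rewrite uV; last by rewrite ref_pyramid_duffy; exists y.
  by rewrite /phi_ref /= !duffyK.
rewrite /L2_inner (changeV u (integrable_pyramid_fun Phi_cont u_duffy)) /mass.
by apply: eq_integral => z /set_mem Dz; rewrite uV.
Qed.

End Orthogonality.
End GaussJacobi.
End Mass.

Theorem lemma2p3 (R : realType) (N : nat) (V : 'I_5 -> R3 R)
    (p : nat -> nat -> nat -> {poly R})
    (x w : forall k : nat, 'I_k.+1 -> R)
    (hV : vertex_mapped V)
    (hp : forall alpha beta : nat, jacobi_orthonormal alpha beta (p alpha beta))
    (hx : forall k : nat, (k <= N)%N ->
      gauss_legendre (p 0%N 0%N k.+1) (x k) (w k)) :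
  [/\ forall (k k' : nat) (i j : 'I_k.+1) (i' j' : 'I_k'.+1),
        (k <= N)%N -> (k' <= N)%N ->
        (nat_of_ord i, nat_of_ord j, k) <> (nat_of_ord i', nat_of_ord j', k') ->
        L2_inner V (phi_phys V p N (x k) i j) (phi_phys V p N (x k') i' j')
          = 0%E,
      forall (k k' : nat) (i j : 'I_k.+1) (i' j' : 'I_k'.+1),
        (k <= N)%N -> (k' <= N)%N ->
        (nat_of_ord i, nat_of_ord j, k) <> (nat_of_ord i', nat_of_ord j', k') ->
        mass V (phi_ref p N (x k) i j) (phi_ref p N (x k') i' j') = 0%E
    & forall (k : nat) (i j : 'I_k.+1) (c : R),
        (k <= N)%N -> -1 <= c < 1 ->
        mass V (phi_ref p N (x k) i j) (phi_ref p N (x k) i j)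
          = (jac V (duffy (x k i, x k j, c)) * w k i * w k j * Cconst R N k)%:E].
Proof.
split=> [k k' i j i' j' kN k'N ne|k k' i j i' j' kN k'N ne|k i j c kN c1].
- by rewrite L2_inner_mass // (mass_phi_orthogonal hp V hx).
- exact: (mass_phi_orthogonal hp V hx).
- rewrite (mass_phi_same hp V hx) // !eqxx !mul1r jac_duffy //.
  by case/andP: c1 => _ c1; rewrite lt_eqF.
Qed.
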